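(* Let $\Delta$ be a finite simplicial complex and $k$ an integer such that the integral boundary operators $\partial_{k+1}:C_{k+1}(\Delta;\mathbb{Z})\to C_k(\Delta;\mathbb{Z})$ and $\partial_k:C_k(\Delta;\mathbb{Z})\to C_{k-1}(\Delta;\mathbb{Z})$ are nonzero. Let $\alpha_1,\dots,\alpha_r$ and $\tilde\alpha_1,\dots,\tilde\alpha_s$ be the elementary divisors of $\partial_{k+1}$ and $\partial_k$, respectively, and let $p$ be any prime such that $\gcd(p,\alpha_r\tilde\alpha_s)=1$. Then \[ H_k(\Delta;\mathbb{Z}_p)\cong\mathbb{Z}_p^{\beta_k}. \]
   Context: $\mathbb{Z}_p=\mathbb{Z}/p\mathbb{Z}$, and $\beta_k$ is the $k$-th Betti number of $\Delta$, i.e. the rank of $H_k(\Delta;\mathbb{Z})$. The boundary operators are identified with their integer matrices in the bases given by the (oriented) simplices of $\Delta$. For a nonzero integer matrix $A$ of rank $r$, the elementary divisors $\alpha_1,\dots,\alpha_r$ are the nonzero diagonal entries of the Smith normal form $UAV=\operatorname{diag}(\alpha_1,\dots,\alpha_r,0,\dots,0)$ of $A$ ($U,V$ invertible over $\mathbb{Z}$), ordered so that $\alpha_i\mid\alpha_{i+1}$ for $1\le i<r$; equivalently $\alpha_i=d_i(A)/d_{i-1}(A)$, where $d_i(A)$ is the greatest common divisor of all $i\times i$ minors of $A$ and $d_0(A)=1$. *)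

(* Defs.v *)
From HB Require Import structures.
From mathcomp Require Import all_boot all_order all_algebra.
From mathcomp Require Import boolp.
From mathcomp Require classical_sets.

Set Implicit Arguments.
Unset Strict Implicit.
Unset Printing Implicit Defensive.

Import Order.TTheory GRing.Theory Num.Theory.

Local Open Scope ring_scope.

(* Faces are nonempty, so that there are no simplices of dimension -1 and the
   homology below is the ordinary, unreduced one.  Elements of V need not all
   be vertices of the complex. *)
Record simplicial_complex (V : finType) := SimplicialComplex {
  faces :> {set {set V}};
  faces_neq0 : set0 \notin faces;
  faces_closed : forall s t : {set V},
    t != set0 -> t \subset s -> s \in faces -> t \in faces
}.

Definition simplices (V : finType) (D : simplicial_complex V) (k : int) :
  {set {set V}} := [set s in faces D | #|s|%:Z == k + 1].

(* The simplices are oriented by the order of V: the boundary of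
   {v_0 < ... < v_k} is the sum of the (-1)^i {v_0, ..., v_k} \ v_i, and the
   sign of the face opposite to v is given by the number of vertices below v.
   The matrix acts on column vectors.  It is indexed by both dimensions i (the
   source) and j (the target) because k + 1 - 1 and k are not convertible; it
   is meant to be used with j = i - 1. *)
Definition boundary_mx (R : nzRingType) (disp : Order.disp_t)
    (V : finOrderType disp) (D : simplicial_complex V) (i j : int) :
    'M[R]_(#|simplices D j|, #|simplices D i|) :=
  \matrix_(a, b)
    let t : {set V} := enum_val a in let s : {set V} := enum_val b in
    \sum_(v in s | s :\ v == t) (-1) ^+ #|[set w in s | (w < v)%O]|.

Section Homology.
Variables (R : comNzRingType) (U V W : lmodType R).
Variables (f : {linear U -> V}) (g : {linear V -> W}).

Definition is_cycle : {pred V} := fun x => g x == 0.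

Lemma is_cycle_submod : submod_closed is_cycle.
Proof.
split=> [|a x y]; rewrite !unfold_in /is_cycle ?raddf0 //.
by move=> /eqP gx /eqP gy; rewrite linearP gx gy scaler0 addr0.
Qed.

HB.instance Definition _ :=
  GRing.isSubmodClosed.Build R V is_cycle is_cycle_submod.

Record cycle := Cycle { cycle_val : V; _ : cycle_val \in is_cycle }.

HB.instance Definition _ := [isSub for cycle_val].
HB.instance Definition _ := [Choice of cycle by <:].
HB.instance Definition _ := [SubChoice_isSubLmodule of cycle by <:].

Definition is_boundary : {pred cycle} :=
  fun z => `[< exists y, f y = cycle_val z >].

Lemma is_boundary_submod : submod_closed is_boundary.
Proof.
split=> [|a x y].
  by apply/asboolP; exists 0; rewrite raddf0 [RHS](raddf0 (val : cycle -> V)).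
move=> /asboolP[u fu] /asboolP[v fv]; apply/asboolP; exists (a *: u + v).
by rewrite linearP fu fv [RHS](linearP (val : cycle -> V)).
Qed.

HB.instance Definition _ :=
  GRing.isSubmodClosed.Build R cycle is_boundary is_boundary_submod.

(* ker g / im f.  The library quotient is only a zmodType; the scalar action
   is added below. *)
Definition homology := Quotient.quot is_boundary.

HB.instance Definition _ := Choice.on homology.
HB.instance Definition _ := GRing.Zmodule.on homology.

Local Notation pi_h := (\pi_(Quotient.quot is_boundary)%qT : cycle -> homology).

Definition homology_scale (a : R) (x : homology) : homology :=
  pi_h (a *: repr x).

Lemma homology_scale_pi a z : homology_scale a (pi_h z) = pi_h (a *: z).
Proof.
apply/eqP; rewrite -Quotient.idealrBE -scalerBr; apply: rpredZ.
by rewrite Quotient.idealrBE reprK.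
Qed.

Lemma homology_scaleA a b x :
  homology_scale a (homology_scale b x) = homology_scale (a * b) x.
Proof. by rewrite homology_scale_pi scalerA. Qed.

Lemma homology_scale1 : left_id 1 homology_scale.
Proof. by move=> x; rewrite /homology_scale scale1r reprK. Qed.

Lemma homology_scaleDr : right_distributive homology_scale +%R.
Proof.
move=> a x y; rewrite -[x]reprK -[y]reprK -(raddfD pi_h) !homology_scale_pi.
by rewrite scalerDr (raddfD pi_h).
Qed.

Lemma homology_scaleDl x : {morph homology_scale^~ x : a b / a + b}.
Proof. by move=> a b; rewrite /homology_scale scalerDl (raddfD pi_h). Qed.

HB.instance Definition _ := GRing.Zmodule_isLmodule.Build R homology
  homology_scaleA homology_scale1 homology_scaleDr homology_scaleDl.

End Homology.

(* H_k(D; R), where C_k(D; R) is the module of column vectors indexed by the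
   k-simplices of D. *)
Definition simplicial_homology (R : comNzRingType) (disp : Order.disp_t)
    (V : finOrderType disp) (D : simplicial_complex V) (k : int) : lmodType R :=
  homology
    (mulmx (boundary_mx R D (k + 1) k) :
      {linear 'cV[R]_#|simplices D (k + 1)| -> 'cV[R]_#|simplices D k|})
    (mulmx (boundary_mx R D k (k - 1)) :
      {linear 'cV[R]_#|simplices D k| -> 'cV[R]_#|simplices D (k - 1)|}).

Definition has_Zfree (A : zmodType) (n : nat) : Prop :=
  exists x : 'I_n -> A, forall c : 'I_n -> int,
    \sum_i x i *~ c i = 0 -> forall i, c i = 0.

(* The largest number of Z-linearly independent elements of A; the default
   value 0 is taken only when there is no such maximum. *)
Definition Zrank (A : zmodType) : nat :=
  classical_sets.xget 0%N (fun n => has_Zfree A n /\ forall m, has_Zfree A m -> (m <= n)%N).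

Definition betti (disp : Order.disp_t) (V : finOrderType disp)
    (D : simplicial_complex V) (k : int) : nat :=
  Zrank (simplicial_homology int D k).

(* The divisors are normalized to be positive, as quotients of gcds of minors
   are.  The bound on size a makes every term of a a diagonal entry. *)
Definition elementary_divisors (m n : nat) (A : 'M[int]_(m, n)) (a : seq int) :
    Prop :=
  [/\ (size a <= minn m n)%N, all (fun d => 0 < d) a, sorted dvdz a &
    exists U : 'M[int]_m, exists V : 'M[int]_n,
      [/\ U \in unitmx, V \in unitmx &
        U *m A *m V = \matrix_(i, j) (a`_i *+ (i == j :> nat))]].

(* Main.v *)
Require Import Defs.
From mathcomp Require Import all_boot all_order all_algebra.
From HB Require Import structures.
From mathcomp Require Import boolp.
From mathcomp Require classical_sets.

Set Implicit Arguments.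
Unset Strict Implicit.
Unset Printing Implicit Defensive.

Import Order.TTheory GRing.Theory Num.Theory.

Local Open Scope ring_scope.

(** Over a field, the homology of a two-step complex given by matrices A and B
with B A = 0, in the middle space of dimension n, is a vector space of
dimension n - rank B - rank A [homology_field].  The same number, with ranks
taken over the rationals, is the rank of the homology over the integers
[Zrank_homology].  Hence the result amounts to saying that the boundary
matrices have the same rank over F_p and over the rationals.  The Smith normal
form shows this: it is obtained by matrices invertible over the integers, hence
invertible after reduction to any field F, so that the rank over F is the
number of elementary divisors as soon as none of them vanishes in F
[rank_elementary_divisors].  None of them vanishes in the rationals, and none
vanishes in F_p since each divides the last one, which is prime to p
[coprime_last_neq0].  That B A = 0 holds for the boundary matrices is
[boundary_mx_comp].

Both dimension counts rest on one splitting [chain_splitting]: matrices K and P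
over a field, with as many columns, respectively rows, as the dimension of the
homology, such that the columns of K are cycles representing a basis of the
homology and P computes the coordinates in it.  Over F_p they give the
isomorphism and its inverse.  For the integers they are taken over the
rationals, and clearing denominators turns K into independent integral classes,
and a rational relation between integral classes into an integral one. *)

(** * Homology as a quotient module *)

Section HomologyModule.
Variables (R : comNzRingType) (U V W : lmodType R).
Variables (f : {linear U -> V}) (g : {linear V -> W}).

Local Notation class :=
  (\pi_(Quotient.quot (is_boundary f (g := g)))%qT :
     Defs.cycle g -> homology f g).

Lemma homology_class_eq0 (z : Defs.cycle g) :
  class z = 0 <-> exists y, f y = cycle_val z.
Proof.
rewrite -(raddf0 class); split=> [/eqP|z_bnd]; last apply/eqP.
  by rewrite -Quotient.idealrBE subr0 => /asboolP.
by rewrite -Quotient.idealrBE subr0; apply/asboolP.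
Qed.

Lemma homology_class_surj (x : homology f g) : exists z, x = class z.
Proof. by exists (repr x); rewrite [RHS]reprK. Qed.

Lemma homology_relation (I : finType) (z : I -> Defs.cycle g) (c : I -> int) :
  \sum_i class (z i) *~ c i = 0 <->
  exists y, f y = \sum_i cycle_val (z i) *~ c i.
Proof.
have -> : \sum_i class (z i) *~ c i = class (\sum_i z i *~ c i).
  by rewrite (raddf_sum class); apply: eq_bigr => i _; rewrite (raddfMz class).
have -> : \sum_i cycle_val (z i) *~ c i = cycle_val (\sum_i z i *~ c i).
  by rewrite [RHS](raddf_sum val); apply: eq_bigr => i _; rewrite (raddfMz val).
exact: homology_class_eq0.
Qed.

(** The universal property of ker g / im f, for maps that are defined on the
whole middle module rather than on cycles only. *)
Lemma homology_desc (X : lmodType R) (h : {linear V -> X}) :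
  (forall y, h (f y) = 0) ->
  exists H : {linear homology f g -> X},
    forall z, H (class z) = h (cycle_val z).
Proof.
move=> hf; pose H (x : homology f g) := h (cycle_val (repr x)).
have H_class z : H (class z) = h (cycle_val z).
  apply/eqP; rewrite -subr_eq0 /H -linearB.
  have /homology_class_eq0[y fy] : class (repr (class z) - z) = 0.
    by rewrite raddfB /= [X in X - _]reprK subrr.
  have -> : cycle_val (repr (class z)) - cycle_val z = f y by rewrite fy.
  by rewrite hf.
have lin_H : linear H.
  move=> a x y; have [u ->] := homology_class_surj x.
  have [v ->] := homology_class_surj y.
  rewrite -[a *: class u]/(homology_scale a (class u)) homology_scale_pi.
  by rewrite -(raddfD class) !H_class [LHS](linearP (h \o val)).
pose H_lin := GRing.isLinear.Build R (homology f g) X *:%R H lin_H.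
pose HL : {linear homology f g -> X} := HB.pack H H_lin.
by exists HL.
Qed.

End HomologyModule.

(** * Two-step complexes over a field *)

(** K spans a complement of im A in ker B, and P is the projection of ker B
onto this complement along im A, read in the basis K.  The subspace calculus of
matrices is about row spaces, hence the transposes in the proof. *)
Lemma chain_splitting (F : fieldType) (m n l d : nat)
    (A : 'M[F]_(n, m)) (B : 'M[F]_(l, n)) :
  B *m A = 0 -> d = (n - \rank B - \rank A)%N ->
  exists (K : 'M_(n, d)) (P : 'M_(d, n)),
    [/\ B *m K = 0, P *m A = 0, P *m K = 1%:M &
        forall q (x : 'M_(n, q)), B *m x = 0 ->
          exists y, x = A *m y + K *m (P *m x)].
Proof.
move=> BA0; set kerB := kermx B^T; set imA := <<A^T>>%MS.
pose S := (kerB :\: imA)%MS.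
have imA_ker : (imA <= kerB)%MS.
  by rewrite genmxE; apply/sub_kermxP; rewrite -trmx_mul BA0 trmx0.
have -> : (n - \rank B - \rank A)%N = \rank S.
  have := mxrank_cap_compl kerB imA; rewrite (capmx_idPr imA_ker) -/S.
  by rewrite mxrank_ker mxrank_tr genmxE mxrank_tr => <-; rewrite addKn.
move=> ->; pose K := row_base S; pose P := proj_mx S imA *m pinvmx K.
have Sdx : (S :&: imA)%MS = 0 := capmx_diff _ _.
have KS : (K :=: S)%MS := eq_row_base S.
exists K^T, P^T; split.
- apply: trmx_inj; rewrite trmx_mul trmxK trmx0; apply/sub_kermxP.
  by rewrite KS diffmxSl.
- apply: trmx_inj; rewrite trmx_mul trmxK trmx0 /P mulmxA.
  by rewrite proj_mx_0 ?mul0mx // genmxE.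
- apply: trmx_inj; rewrite trmx_mul !trmxK trmx1 /P mulmxA.
  by rewrite proj_mx_id ?KS // mulmxVp // row_base_free.
move=> q x Bx0.
have xK : (x^T <= S + imA)%MS.
  rewrite -(adds_eqmx (eqmx_refl S) (capmx_idPr imA_ker)) addsmx_diff_cap_eq.
  by apply/sub_kermxP; rewrite -trmx_mul Bx0 trmx0.
have /submxP[y y_def] : (x^T *m proj_mx imA S <= A^T)%MS.
  by rewrite -(genmxE A^T) proj_mx_sub.
have xPK : x^T *m P *m K = x^T *m proj_mx S imA.
  by rewrite [X in X *m K]mulmxA mulmxKpV // KS proj_mx_sub.
exists y^T; apply: trmx_inj; rewrite linearD /= !trmx_mul !trmxK -y_def xPK.
by rewrite addrC add_proj_mx.
Qed.

(** The isomorphism is induced by P, and its inverse sends a vector of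
coordinates to the class of the corresponding combination of columns of K. *)
Lemma homology_field (F : fieldType) (m n l d : nat)
    (A : 'M[F]_(n, m)) (B : 'M[F]_(l, n)) :
  B *m A = 0 -> d = (n - \rank B - \rank A)%N ->
  exists f : {linear homology (mulmx A : {linear 'cV[F]_m -> 'cV[F]_n})
                              (mulmx B : {linear 'cV[F]_n -> 'cV[F]_l})
              -> 'rV[F]_d}, bijective f.
Proof.
move=> BA0 /(chain_splitting BA0)[K [P [BK0 PA0 PK1 split]]].
pose f := mulmx A : {linear 'cV[F]_m -> 'cV[F]_n}.
pose g := mulmx B : {linear 'cV[F]_n -> 'cV[F]_l}.
pose h := (trmx \o mulmx P) : {linear 'cV[F]_n -> 'rV[F]_d}.
have hf y : h (f y) = 0 by rewrite /= mulmxA PA0 mul0mx trmx0.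
have [H H_class] := homology_desc g hf; exists H.
have K_cycle (v : 'rV_d) : K *m v^T \in is_cycle g.
  by rewrite unfold_in /= mulmxA BK0 mul0mx.
pose class := \pi_(Quotient.quot (is_boundary f (g := g)))%qT :
  Defs.cycle g -> homology f g.
exists (fun v => class (Cycle (K_cycle v))); last first.
  by move=> v; rewrite H_class /= mulmxA PK1 mul1mx trmxK.
move=> x; have [z ->] := homology_class_surj x; rewrite H_class.
apply/eqP; rewrite eq_sym -subr_eq0 -(raddfB class); apply/eqP.
have [y yE] : exists y, cycle_val z = A *m y + K *m (P *m cycle_val z).
  by apply: split; apply/eqP; apply: (valP z).
apply/homology_class_eq0; exists y.
by rewrite [RHS](raddfB val) /= trmxK [X in _ = X - _]yE addrK.
Qed.

(** * The rank of integral homology *)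

Lemma map_intr_inj (m n : nat) :
  injective (map_mx intr : 'M[int]_(m, n) -> 'M[rat]_(m, n)).
Proof.
move=> M N /matrixP MN; apply/matrixP=> i j.
by have := MN i j; rewrite !mxE; apply: intr_inj.
Qed.

Lemma clear_denominators (m n : nat) (M : 'M[rat]_(m, n)) :
  exists2 c : int, c != 0 &
    exists N : 'M[int]_(m, n), map_mx intr N = c%:~R *: M.
Proof.
pose c := \prod_(ij : 'I_m * 'I_n) denq (M ij.1 ij.2).
exists c; first by apply/prodf_neq0 => ij _; apply: denq_neq0.
exists (\matrix_(i, j)
  (numq (M i j) * \prod_(ij | ij != (i, j)) denq (M ij.1 ij.2))).
apply/matrixP=> i j; rewrite !mxE.
have -> : c = denq (M i j) * \prod_(ij | ij != (i, j)) denq (M ij.1 ij.2).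
  by rewrite /c (bigD1 (i, j)).
by rewrite 2!intrM numqE [RHS]mulrC mulrA.
Qed.

Lemma ZrankE (A : zmodType) (d : nat) :
  has_Zfree A d -> (forall m, has_Zfree A m -> (m <= d)%N) -> Zrank A = d.
Proof.
move=> free_d max_d; apply: classical_sets.xget_unique => // m [free_m max_m].
by apply/eqP; rewrite eqn_leq max_d // max_m.
Qed.

(** Tensoring with the rationals kills the torsion of the homology.  If K and
P split the rational complex, then a multiple of K is integral, and applying P
to an integral relation between the classes of its columns shows that it is
trivial.  Conversely, given more classes than the rational dimension, their
coordinates under P are linearly dependent; the resulting relation and the
chain that bounds it are rational, and become integral after multiplication by
a common denominator. *)
Lemma Zrank_homology (m n l : nat) (A : 'M[int]_(n, m)) (B : 'M[int]_(l, n)) :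
  B *m A = 0 ->
  Zrank (homology (mulmx A : {linear 'cV[int]_m -> 'cV[int]_n})
                  (mulmx B : {linear 'cV[int]_n -> 'cV[int]_l})) =
  (n - \rank (map_mx intr B : 'M[rat]_(l, n))
     - \rank (map_mx intr A : 'M[rat]_(n, m)))%N.
Proof.
move=> BA0.
set A' : 'M[rat]_(n, m) := map_mx _ A; set B' : 'M[rat]_(l, n) := map_mx _ B.
have BA0' : B' *m A' = 0 by rewrite -map_mxM BA0 map_mx0.
have [K [P [BK0 PA0 PK1 split]]] := chain_splitting BA0' erefl.
set d := (_ - _)%N in K P BK0 PA0 PK1 split *.
pose f := mulmx A : {linear 'cV[int]_m -> 'cV[int]_n}.
pose g := mulmx B : {linear 'cV[int]_n -> 'cV[int]_l}.
pose class := \pi_(Quotient.quot (is_boundary f (g := g)))%qT :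
  Defs.cycle g -> homology f g.
have relation N (z : 'I_N -> Defs.cycle g) (c : 'I_N -> int) :
    \sum_i class (z i) *~ c i = 0 <->
    exists y : 'cV_m, A *m y =
      (\matrix_(a, i) cycle_val (z i) a 0) *m \col_i c i.
  have -> : (\matrix_(a, i) cycle_val (z i) a 0) *m \col_i c i =
            \sum_i cycle_val (z i) *~ c i.
    apply/colP=> a; rewrite mxE summxE; apply: eq_bigr => i _.
    by rewrite -scaler_int !mxE intz mulrC.
  exact: homology_relation.
apply: ZrankE.
- have [c c0 [K0 K0E]] := clear_denominators K.
  have K0_cycle i : col i K0 \in is_cycle g.
    rewrite unfold_in /= colE mulmxA.
    suff -> : B *m K0 = 0 by rewrite mul0mx.
    apply: map_intr_inj.
    by rewrite map_mxM /= K0E -scalemxAr BK0 scaler0 map_mx0.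
  exists (fun i => class (Cycle (K0_cycle i))) => u /relation[y].
  have -> : \matrix_(a, i) cycle_val (Cycle (K0_cycle i)) a 0 = K0.
    by apply/matrixP=> a i; rewrite !mxE.
  move/(congr1 (fun v => P *m map_mx intr v)).
  rewrite !map_mxM !mulmxA PA0 mul0mx K0E -scalemxAr PK1 => u0 i.
  move/colP/(_ i)/eqP: u0; rewrite -scalemxAl mul1mx !mxE eq_sym -intrM.
  by rewrite intr_eq0 mulf_eq0 (negPf c0) => /eqP.
move=> N [x x_free]; rewrite leqNgt; apply/negP => dN.
(* Z has representatives of the N > d given classes as its columns. *)
pose z i := repr (x i); pose Z := \matrix_(a, i) cycle_val (z i) a 0.
have Bz0 i : B *m cycle_val (z i) = 0 by apply/eqP/(valP (z i)).
have colZ i : col i Z = cycle_val (z i) by apply/colP=> a; rewrite !mxE.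
have BZ0 : B *m Z = 0.
  apply/matrixP=> a i.
  transitivity (col i (B *m Z) a 0); first by rewrite [RHS]mxE.
  by rewrite colE -mulmxA -colE colZ Bz0 !mxE.
set Z' : 'M[rat]_(n, N) := map_mx intr Z.
have [|y] := split _ (Z' *m cokermx (P *m Z')).
  by rewrite mulmxA -map_mxM BZ0 map_mx0 mul0mx.
rewrite (mulmxA P) mulmx_coker mulmx0 addr0.
have {dN} ker_neq0 : cokermx (P *m Z') != 0.
  rewrite -mxrank_eq0 mxrank_coker subn_eq0 -ltnNge.
  exact: leq_ltn_trans (rank_leq_row _) dN.
(* The columns of C are the rational relations between the coordinates of the
   classes.  Denominators are cleared in C and y at once, so that the integral
   chain still bounds the integral combination. *)
set C := cokermx _ => ZCE.
have [c c0 [T TE]] := clear_denominators (col_mx C y).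
have [CE yE] : map_mx intr (usubmx T) = c%:~R *: C /\
               map_mx intr (dsubmx T) = c%:~R *: y.
  by rewrite map_usubmx map_dsubmx TE !scale_col_mx col_mxKu col_mxKd.
have ZTE : Z *m usubmx T = A *m dsubmx T.
  apply: map_intr_inj.
  by rewrite !map_mxM CE yE -!scalemxAr ZCE.
case/negP: ker_neq0; apply/eqP.
suff T0 : usubmx T = 0.
  apply/eqP; move: CE; rewrite T0 map_mx0 => /esym/eqP.
  by rewrite scaler_eq0 intr_eq0 (negPf c0).
apply/matrixP=> i j; rewrite [RHS]mxE.
apply: (x_free (usubmx T ^~ j)).
have -> : \sum_i x i *~ usubmx T i j = \sum_i class (z i) *~ usubmx T i j.
  by apply: eq_bigr => i' _; rewrite /class /z [X in _ = X *~ _]reprK.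
apply/relation; exists (col j (dsubmx T)).
have -> : \col_i usubmx T i j = col j (usubmx T).
  by apply/colP=> i'; rewrite !mxE.
by rewrite -/Z !colE !mulmxA ZTE.
Qed.

(** * Elementary divisors and ranks *)

(** The diagonal matrix of the normal form is an invertible diagonal matrix
times a partial identity matrix of rank the number of divisors; the entries of
the former beyond the divisors are set to 1. *)
Lemma rank_elementary_divisors (F : fieldType) (m n : nat)
    (A : 'M[int]_(m, n)) (a : seq int) :
  elementary_divisors A a -> {in a, forall d, d%:~R != 0 :> F} ->
  \rank (map_mx intr A : 'M[F]_(m, n)) = size a.
Proof.
case=> size_a _ _ [U [V [U_unit V_unit UAV]]] a_neq0.
have intr_unit q (M : 'M[int]_q) : M \in unitmx ->
    (map_mx intr M : 'M[F]_q) \in unitmx.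
  by rewrite !unitmxE det_map_mx; apply: rmorph_unit.
have rankUAV : \rank (map_mx intr (U *m A *m V) : 'M[F]_(m, n)) =
               \rank (map_mx intr A : 'M[F]_(m, n)).
  rewrite !map_mxM mxrankMfree ?row_free_unit ?intr_unit //.
  by rewrite eqmxMfull // row_full_unit intr_unit.
rewrite -rankUAV UAV.
pose v : 'rV[F]_m := \row_i (if (i < size a)%N then (a`_i)%:~R else 1).
have v_unit : diag_mx v \in unitmx.
  rewrite unitmxE det_diag unitfE; apply/prodf_neq0 => i _; rewrite mxE.
  by case: ifP => [ia|_]; rewrite ?oner_neq0 ?a_neq0 ?mem_nth.
have -> : map_mx intr (\matrix_(i, j) (a`_i *+ (i == j :> nat))) =
          diag_mx v *m pid_mx (size a) :> 'M[F]_(m, n).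
  apply/matrixP=> i j; rewrite mul_diag_mx !mxE.
  have [ij|_] /= := eqVneq (i : nat) j; last by rewrite mulr0.
  case: ltnP => [_|ai]; first by rewrite mulr1.
  by rewrite nth_default // mulr0.
rewrite eqmxMfull ?row_full_unit // rank_pid_mx //.
  exact: leq_trans size_a (geq_minl _ _).
exact: leq_trans size_a (geq_minr _ _).
Qed.

(** The divisors form a divisibility chain, so a prime dividing any of them
divides the last one. *)
Lemma coprime_last_neq0 (p : nat) (a : seq int) :
  prime p -> sorted dvdz a -> coprimez p a`_(size a).-1 ->
  {in a, forall d, d%:~R != 0 :> 'F_p}.
Proof.
move=> p_pr a_sorted cop d da; rewrite -(dvdz_pcharf (pchar_Fp p_pr)).
have da' : (d %| a`_(size a).-1)%Z.
  rewrite -(nth_index 0 da); apply: (sorted_leq_nth (@dvdz_trans) dvdzz) => //.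
  - by rewrite inE index_mem.
  - by rewrite inE prednK //; case: (a) da.
  - by rewrite -ltnS prednK ?index_mem //; case: (a) da.
apply/negP=> pd; have := dvdz_trans pd da'.
move: cop; rewrite coprimezE dvdzE prime_coprime // => /negPf.
by rewrite /= => ->.
Qed.

(** * Simplicial boundary matrices *)

Lemma sum_antisym (R : numDomainType) (I : finType) (G : I -> I -> R) :
  (forall i j, G i j = - G j i) -> \sum_i \sum_j G i j = 0.
Proof.
move=> antiG; set S := LHS; apply/eqP.
suff /eqP : S *+ 2 = 0 by rewrite mulrn_eq0.
rewrite /S.
rewrite mulr2n [X in X + _]exchange_big -big_split big1 //= => i _.
by rewrite -big_split big1 //= => j _; rewrite [G j i]antiG addNr.
Qed.

(** The entries are sums of signs, so the boundary over any ring comes from the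
integral one. *)
Lemma boundary_mx_map (R : nzRingType) (disp : Order.disp_t)
    (V : finOrderType disp) (D : simplicial_complex V) (i j : int) :
  boundary_mx R D i j = map_mx intr (boundary_mx int D i j).
Proof.
apply/matrixP=> a b; rewrite !mxE rmorph_sum /=; apply: eq_bigr => v _.
by rewrite rmorphXn rmorphN rmorph1.
Qed.

Lemma simplices_facet (disp : Order.disp_t) (V : finOrderType disp)
    (D : simplicial_complex V) (i : int) (u : {set V}) (w v : V) :
  u \in simplices D (i + 1) -> w \in u -> v \in u :\ w ->
  u :\ w \in simplices D i.
Proof.
rewrite !inE => /andP[uD /eqP cu] wu vu; apply/andP; split.
  apply: (faces_closed _ (subD1set u w) uD).
  by apply/set0Pn; exists v; rewrite !inE.
apply/eqP/(addrI 1).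
by rewrite addrC [RHS]addrC -cu (cardsD1 w u) wu PoszD addrC.
Qed.

(** Removing the vertex w lowers the position of v exactly when w < v; this is
the source of the signs that cancel in the square of the boundary. *)
Lemma card_below_D1 (disp : Order.disp_t) (V : finOrderType disp)
    (u : {set V}) (w v : V) : w \in u ->
  #|[set x in u | (x < v)%O]| =
  ((w < v)%O + #|[set x in u :\ w | (x < v)%O]|)%N.
Proof.
move=> wu; rewrite (cardsD1 w) !inE wu /=; congr (_ + _)%N.
by apply: eq_card => x; rewrite !inE andbA.
Qed.

(** The coefficient of t in the double boundary of u is a sum over the ordered
pairs of vertices (w, v) of u whose removal, w first, leaves t.  Exchanging the
two vertices changes the sign: if w < v, the position of v drops by one when w
is removed first, while that of w does not depend on v. *)
Lemma boundary_mx_comp (disp : Order.disp_t)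
    (V : finOrderType disp) (D : simplicial_complex V) (k : int) :
  boundary_mx int D k (k - 1) *m boundary_mx int D (k + 1) k = 0.
Proof.
apply/matrixP=> a b; rewrite !mxE.
set t : {set V} := enum_val a; set u : {set V} := enum_val b.
have uD : u \in simplices D (k + 1) by apply: enum_valP.
pose sg (s : {set V}) v : int := (-1) ^+ #|[set x in s | (x < v)%O]|.
pose G w v := if [&& w \in u, v \in u :\ w & u :\ w :\ v == t]
  then sg (u :\ w) v * sg u w else 0.
transitivity (\sum_w \sum_v G w v); last first.
  apply: sum_antisym => w v; rewrite /G !inE.
  have -> : u :\ v :\ w = u :\ w :\ v by rewrite !setDDl setUC.
  have [->|nwv] := eqVneq w v; first by rewrite !andbF oppr0.
  rewrite /=; have [wu|] := boolP (w \in u); last by rewrite !andbF oppr0.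
  have [vu|] := boolP (v \in u); last by rewrite !andbF oppr0.
  rewrite /=; case: ifP => _; last by rewrite oppr0.
  rewrite /sg (card_below_D1 w vu) (card_below_D1 v wu) !exprD.
  by case: (ltgtP w v) nwv => // _ _;
    rewrite expr0 expr1 mul1r mulN1r mulrN ?opprK mulrC.
transitivity (\sum_(s in simplices D k)
   (\sum_(v in s | s :\ v == t) sg s v) * (\sum_(w in u | u :\ w == s) sg u w)).
  rewrite [RHS]big_enum_val /=.
  by apply: eq_bigr => c _; rewrite !mxE.
transitivity (\sum_(s in simplices D k) \sum_(w in u | u :\ w == s)
   (\sum_(v in u :\ w | u :\ w :\ v == t) sg (u :\ w) v) * sg u w).
  apply: eq_bigr => s _; rewrite big_distrr /=.
  by apply: eq_bigr => w /andP[_ /eqP ->].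
under eq_bigr do rewrite big_mkcondr /=.
rewrite exchange_big big_mkcond /=; apply: eq_bigr => w _.
rewrite /G; have [wu|] := boolP (w \in u); last by rewrite /= big1.
rewrite -big_mkcondr -big_mkcond mulr_suml /=.
have [uwD|uwND] := boolP (u :\ w \in simplices D k).
  rewrite (eq_bigl (pred1 (u :\ w))) ?big_pred1_eq // => s.
  by rewrite /= eq_sym andbC; case: eqP => // ->.
rewrite big_pred0 => [|s]; last first.
  by case: eqP => [<-|]; rewrite ?(negPf uwND) ?andbF.
by rewrite big1 // => v /andP[/(simplices_facet uD wu)]; rewrite (negPf uwND).
Qed.

(** * Homology over F_p *)

Theorem proposition4p1 (disp : Order.disp_t) (V : finOrderType disp)
    (D : simplicial_complex V) (k : int)
    (nz1 : boundary_mx int D (k + 1) k != 0)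
    (nz0 : boundary_mx int D k (k - 1) != 0)
    (alpha alpha' : seq int)
    (Halpha : elementary_divisors (boundary_mx int D (k + 1) k) alpha)
    (Halpha' : elementary_divisors (boundary_mx int D k (k - 1)) alpha')
    (p : nat) (p_prime : prime p)
    (coprime_p :
      gcdz p%:Z (alpha`_(size alpha).-1 * alpha'`_(size alpha').-1) = 1) :
  exists f : {linear simplicial_homology 'F_p D k -> 'rV['F_p]_(betti D k)},
    bijective f.
Proof.
have bb0 := boundary_mx_comp D k.
have /andP[cop cop'] : coprimez p alpha`_(size alpha).-1 &&
                       coprimez p alpha'`_(size alpha').-1.
  by rewrite -coprimezMr /coprimez coprime_p.
have [_ pos srt _] := Halpha; have [_ pos' srt' _] := Halpha'.
have rat_neq0 (a : seq int) : all (fun d => 0 < d) a ->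
    {in a, forall d, d%:~R != 0 :> rat}.
  by move=> /allP a_gt0 d /a_gt0 d_gt0; rewrite intr_eq0 gt_eqF.
apply: homology_field.
  rewrite (boundary_mx_map 'F_p D k) (boundary_mx_map _ D (k + 1)).
  by rewrite -map_mxM bb0 map_mx0.
rewrite (boundary_mx_map 'F_p D k) (boundary_mx_map _ D (k + 1)).
have a_neq0 := coprime_last_neq0 p_prime srt cop.
rewrite (rank_elementary_divisors Halpha a_neq0).
have a'_neq0 := coprime_last_neq0 p_prime srt' cop'.
rewrite (rank_elementary_divisors Halpha' a'_neq0).
rewrite /betti /simplicial_homology Zrank_homology //.
rewrite (rank_elementary_divisors Halpha (rat_neq0 _ pos)).
by rewrite (rank_elementary_divisors Halpha' (rat_neq0 _ pos')).
Qed.
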